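(* Let $0\le J<K$ be integers. Suppose that the refinement relations $$\widehat\alpha(2\xi)=\widehat a(\xi)\widehat\alpha(\xi),\qquad\widehat{\beta^k}(2\xi)=\widehat{b^k}(\xi)\widehat\alpha(\xi),\quad k=1,\ldots,r,$$ and the filter-bank partition $$\left|\widehat a(\lambda_\ell/2^j)\right|^2+\sum_{k=1}^r\left|\widehat{b^k}(\lambda_\ell/2^j)\right|^2=1,\qquad\ell\in\Lambda_j^\alpha,\ j>J,$$ hold. Let $C_{\mathrm{prod}}\ge2$ be a product-bandwidth constant. Assume, for every $j=J,\ldots,K$, that the level-$j$ sampling rule is exact for polynomials of degree up to $C_{\mathrm{prod}}2^j$, i.e. $\int_{\mathcal M}P\,d\mu=\sum_{x\in\boldsymbol X_j}w_{j,x}P(x)$ for all $P\in\mathbb P_{C_{\mathrm{prod}}2^j}$, and that the corresponding product condition holds, i.e. $P\overline Q\in\mathbb P_{C_{\mathrm{prod}}2^j}$ for all $P,Q\in\mathbb P_{2^j}$. Then $$\mathcal A_{J,K}^*\mathcal A_{J,K}=I\quad\text{on }\mathbb C^{\Lambda_K^\alpha}.$$ Consequently, if $\mathbf c=\mathcal A_{J,K}\widehat{\mathbf v}_K$, then the one-pass synthesis algorithm (see context) applied to $\mathbf c$ returns $\widehat{\mathbf v}_K$ after one pass.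
   Context: $(\mathcal M,g)$ is a compact, connected, $d$-dimensional smooth Riemannian manifold without boundary, $\mu$ its normalized Riemannian volume measure. $\{u_\ell\}_{\ell\ge0}$ is an orthonormal basis of $L^2(\mu)$ with $-\Delta_{\mathcal M}u_\ell=\lambda_\ell^2u_\ell$ ($\Delta_{\mathcal M}$ the Laplace--Beltrami operator), $0=\lambda_0\le\lambda_1\le\cdots\to\infty$; $\mathbb P_n=\operatorname{span}\{u_\ell:\lambda_\ell\le n\}$. A product-bandwidth constant is a constant $C_{\mathrm{prod}}\ge2$ depending on the manifold such that $P\overline Q\in\mathbb P_{C_{\mathrm{prod}}2^j}$ for all $P,Q\in\mathbb P_{2^j}$. Generators $\alpha,\beta^1,\ldots,\beta^r\in L_1(\mathbb R)$, $\widehat h(\xi)=\int_{\mathbb R}h(t)e^{-2\pi it\xi}dt$, with $(\operatorname{supp}\widehat\alpha\cap[0,\infty))\cup\bigcup_k(\operatorname{supp}\widehat{\beta^k}\cap[0,\infty))\subset[0,1]$; filters $a,b^1,\ldots,b^r\in\ell_1(\mathbb Z)$ with symbols $\widehat a(\xi)=\sum_ma_me^{-2\pi im\xi}$, $\widehat{b^k}(\xi)=\sum_mb^k_me^{-2\pi im\xi}$. $\Lambda_j^\alpha=\{\ell\ge0:\widehat\alpha(\lambda_\ell/2^j)\ne0\}\subset\{\ell:\lambda_\ell\le2^j\}$, $j\ge J$, with the standing assumption $\Lambda_{j-1}^\alpha\subset\Lambda_j^\alpha$. $\boldsymbol X_j\subset\boldsymbol X_{j+1}$ are nested finite subsets of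 $\mathcal M$ with positive weights $w_{j,x}$ (the level-$j$ sampling rule). $\mathbf F_j:\mathbb C^{\Lambda_j^\alpha}\to\mathbb C^{\boldsymbol X_j}$, $(\mathbf F_j\widehat{\mathbf z})(x)=\sum_{\ell\in\Lambda_j^\alpha}z_\ell w_{j,x}^{1/2}u_\ell(x)$, with adjoint $(\mathbf F_j^*\mathbf v)_\ell=\sum_{x\in\boldsymbol X_j}v_xw_{j,x}^{1/2}\overline{u_\ell(x)}$. Analysis operator $\mathcal A_{J,K}:\mathbb C^{\Lambda_K^\alpha}\to\mathbb C^{\boldsymbol X_J}\times\prod_{j=J+1}^K(\mathbb C^{\boldsymbol X_j})^r$: given $\widehat{\mathbf v}_K$, for $j=K,K-1,\ldots,J+1$ set $\widehat w^k_{j-1,\ell}=\widehat v_{j,\ell}\overline{\widehat{b^k}(\lambda_\ell/2^j)}$ ($\ell\in\Lambda_j^\alpha$), $\mathbf w^k_{j-1}=\mathbf F_j\widehat{\mathbf w}^k_{j-1}$, $\widehat v_{j-1,\ell}=\widehat v_{j,\ell}\overline{\widehat a(\lambda_\ell/2^j)}$ ($\ell\in\Lambda_{j-1}^\alpha$); then $\mathbf v_J=\mathbf F_J\widehat{\mathbf v}_J$ and $\mathcal A_{J,K}\widehat{\mathbf v}_K=(\mathbf v_J,\{\mathbf w^k_{j-1}\}_{J<j\le K,\,1\le k\le r})$. Adjoints are with respect to standard Euclidean inner products. One-pass synthesis algorithm: for $\mathbf c=(\mathbf c_J,\{\mathbf c^k_{j-1}\}_{J<j\le K,1\le k\le r})$,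 set $\widehat{\mathbf z}_J=\mathbf F_J^*\mathbf c_J$ and, for $j=J+1,\ldots,K$ and $\ell\in\Lambda_j^\alpha$, $\widehat z_{j,\ell}=(\mathcal E_{j-1}^j\widehat{\mathbf z}_{j-1})_\ell\,\widehat a(\lambda_\ell/2^j)+\sum_{k=1}^r(\mathbf F_j^*\mathbf c^k_{j-1})_\ell\,\widehat{b^k}(\lambda_\ell/2^j)$, where $\mathcal E_{j-1}^j:\mathbb C^{\Lambda_{j-1}^\alpha}\to\mathbb C^{\Lambda_j^\alpha}$ is extension by zero; return $\widehat{\mathbf z}_K$. *)

(* Defs.v *)
From HB Require Import structures.
From mathcomp Require Export all_boot all_order all_algebra finmap.
From mathcomp Require Export all_classical all_reals all_analysis.
From mathcomp Require Export complex.

Set Implicit Arguments.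
Unset Strict Implicit.
Unset Printing Implicit Defensive.

Export Order.TTheory GRing.Theory Num.Theory numFieldNormedType.Exports.

Local Open Scope classical_set_scope.
Local Open Scope ring_scope.

Section calculus.
Context {R : realType}.

Definition partial (d : nat) (p : 'I_d) (f : 'rV[R]_d -> R) : 'rV[R]_d -> R :=
  fun x => 'D_(delta_mx 0 p) f x.

(* f is of class C^n on the open set U *)
Fixpoint Cn_on (d n : nat) (U : set 'rV[R]_d) (f : 'rV[R]_d -> R) : Prop :=
  (forall x, U x -> {for x, continuous f}) /\
  if n is m.+1 then
    forall p : 'I_d, (forall x, U x -> derivable f x (delta_mx 0 p)) /\
                     Cn_on m U (partial p f)
  else True.

Definition smooth_on (d : nat) (U : set 'rV[R]_d) (f : 'rV[R]_d -> R) : Prop :=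
  forall n, Cn_on n U f.

(* The Lebesgue integral over R^n of a nonnegative Borel function, as an
   iterated integral (Tonelli). *)
Fixpoint lebesgue_int (n : nat) : ('rV[R]_n -> \bar R) -> \bar R :=
  match n with
  | 0%N => fun F => F 0
  | m.+1 => fun F => (\int[@lebesgue_measure R]_t
              lebesgue_int (fun y : 'rV[R]_m => F (row_mx (t%:M : 'rV_1) y)))%E
  end.

End calculus.

Section manifolds.
Context {R : realType}.

Record chart (d : nat) (M : topologicalType) := Chart {
  dom : set M ;
  cod : set 'rV[R]_d ;
  fwd : M -> 'rV[R]_d ;
  bwd : 'rV[R]_d -> M ;
  dom_open : open dom ;
  cod_open : open cod ;
  fwd_cod : forall p, dom p -> cod (fwd p) ;
  bwd_dom : forall x, cod x -> dom (bwd x) ;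
  fwdK : forall p, dom p -> bwd (fwd p) = p ;
  bwdK : forall x, cod x -> fwd (bwd x) = x ;
  fwd_continuous : forall p, dom p -> {for p, continuous fwd} ;
  bwd_continuous : forall x, cod x -> {for x, continuous bwd} }.

(* coordinate change from c1 to c2, meaningful on [overlap c1 c2] *)
Definition transition d M (c1 c2 : chart d M) (x : 'rV[R]_d) : 'rV[R]_d :=
  fwd c2 (bwd c1 x).

Definition overlap d M (c1 c2 : chart d M) : set 'rV[R]_d :=
  [set x | cod c1 x /\ dom c2 (bwd c1 x)].

(* A smooth atlas of dimension d on M together with a Riemannian metric given
   by its Gram matrices in the coordinates of each chart. *)
Record riemannian (d : nat) (M : topologicalType) := Riemannian {
  chart_index : Type ;
  charts : chart_index -> chart d M ;
  charts_cover : forall p : M, exists i, dom (charts i) p ;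
  charts_compat : forall i j (q : 'I_d),
    smooth_on (overlap (charts i) (charts j))
      (fun x => transition (charts i) (charts j) x 0 q) ;
  metric : chart_index -> 'rV[R]_d -> 'M[R]_d ;
  metric_smooth : forall i (p q : 'I_d),
    smooth_on (cod (charts i)) (fun x => metric i x p q) ;
  metric_sym : forall i x, cod (charts i) x -> (metric i x)^T = metric i x ;
  metric_pos : forall i x, cod (charts i) x ->
    forall v : 'rV[R]_d, v != 0 -> 0 < (v *m metric i x *m v^T) 0 0 ;
  metric_compat : forall i j x, overlap (charts i) (charts j) x ->
    let jac : 'M[R]_d := \matrix_(p, q)
      partial p (fun y => transition (charts i) (charts j) y 0 q) x in
    metric i x =
      jac *m metric j (transition (charts i) (charts j) x) *m jac^T }.

Definition density d M (g : riemannian d M) (i : chart_index g)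
    (x : 'rV[R]_d) : R := Num.sqrt (\det (metric i x)).

Definition smooth_fun d M (g : riemannian d M) (f : M -> R) : Prop :=
  forall i : chart_index g,
    smooth_on (cod (charts i)) (fun x => f (bwd (charts i) x)).

(* The Laplace-Beltrami operator in the coordinates of the chart i:
   |g|^(-1/2) \sum_p d_p (|g|^(1/2) \sum_q g^(pq) d_q f). *)
Definition laplace_beltrami d M (g : riemannian d M) (i : chart_index g)
    (f : M -> R) (x : 'rV[R]_d) : R :=
  (density i x)^-1 *
  \sum_(p < d) partial p
    (fun y => density i y * \sum_(q < d) invmx (metric i y) p q *
                partial q (fun z => f (bwd (charts i) z)) y) x.

Definition laplace_eigenfun d M (g : riemannian d M) (e : R) (f : M -> R) :
    Prop :=
  smooth_fun g f /\
  forall (i : chart_index g) x, cod (charts i) x ->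
    - laplace_beltrami i f x = e * f (bwd (charts i) x).

Definition borel (M : ptopologicalType) := g_sigma_algebraType (@open M).

Definition riemannian_volume d (M : ptopologicalType) (g : riemannian d M)
    (vol : {measure set (borel M) -> \bar R}) : Prop :=
  forall (i : chart_index g) (A : set (borel M)),
    measurable A -> A `<=` dom (charts i) ->
    vol A = lebesgue_int
      (fun x => (\1_(fwd (charts i) @` A) x * density i x)%:E).

Definition normalized_volume d (M : ptopologicalType) (g : riemannian d M)
    (mu : {measure set (borel M) -> \bar R}) : Prop :=
  exists2 vol : {measure set (borel M) -> \bar R}, riemannian_volume g vol &
    forall A : set (borel M), measurable A ->
      mu A = (fine (vol A) / fine (vol setT))%:E.

End manifolds.
Arguments chart : clear implicits.
Arguments riemannian : clear implicits.

Section complex_analysis.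
Context {R : realType}.

Definition cabs (z : R[i]) : R := ComplexField.Normc.normc z.

Definition Cintegral disp (T : measurableType disp)
    (mu : {measure set T -> \bar R}) (f : T -> R[i]) : R[i] :=
  Complex (Rintegral mu setT (fun x => complex.Re (f x)))
          (Rintegral mu setT (fun x => complex.Im (f x))).

Definition Cintegrable disp (T : measurableType disp)
    (mu : {measure set T -> \bar R}) (f : T -> R[i]) : Prop :=
  mu.-integrable setT (fun x => (complex.Re (f x))%:E) /\
  mu.-integrable setT (fun x => (complex.Im (f x))%:E).

Definition inL2 disp (T : measurableType disp)
    (mu : {measure set T -> \bar R}) (f : T -> R[i]) : Prop :=
  [/\ measurable_fun setT (fun x => complex.Re (f x)),
      measurable_fun setT (fun x => complex.Im (f x)) &
      (\int[mu]_x (cabs (f x) ^+ 2)%:E < +oo)%E].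

Definition L2dot disp (T : measurableType disp)
    (mu : {measure set T -> \bar R}) (f h : T -> R[i]) : R[i] :=
  Cintegral mu (fun x => f x * (h x)^*).

Definition orthonormal_basis disp (T : measurableType disp)
    (mu : {measure set T -> \bar R}) (u : nat -> T -> R[i]) : Prop :=
  [/\ forall l, inL2 mu (u l),
      forall l m, L2dot mu (u l) (u m) = (l == m)%:R &
      forall f, inL2 mu f ->
        (\int[mu]_x
           (cabs (f x - \sum_(l < n) L2dot mu f (u l) * u l x) ^+ 2)%:E)%E
        @[n --> \oo] --> 0%E].

Definition expi (t : R) : R[i] := Complex (cos t) (sin t).

Definition fourier (h : R -> R[i]) (xi : R) : R[i] :=
  Cintegral (@lebesgue_measure R)
    (fun t : R => h t * expi (- (2 * pi * t * xi))).

Definition in_l1 (a : int -> R[i]) : Prop :=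
  esum.summable setT (fun m => (cabs (a m))%:E).

(* \sum_(m in Z) a_m e^(-2 pi i m xi), as the limit of the partial sums over
   -n <= m <= n *)
Definition symbol (a : int -> R[i]) (xi : R) : R[i] :=
  let term (n k : nat) : R[i] :=
    let m : int := k%:Z - n%:Z in a m * expi (- (2 * pi * m%:~R * xi)) in
  Complex (limn (fun n => \sum_(k < n.*2.+1) complex.Re (term n k)))
          (limn (fun n => \sum_(k < n.*2.+1) complex.Im (term n k))).

Definition support (f : R -> R[i]) : set R := closure [set x | f x != 0].

End complex_analysis.

Section polynomials.
Context {R : realType} {M : Type} (u : nat -> M -> R[i]) (lam : nat -> R).

Definition diffusion_poly (n : R) (P : M -> R[i]) : Prop :=
  exists (s : seq nat) (c : nat -> R[i]),
    (forall l, l \in s -> lam l <= n) /\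
    P = (fun x => \sum_(l <- s) c l * u l x).

Definition product_condition (C : R) (j : nat) : Prop :=
  forall P Q, diffusion_poly (2 ^+ j) P -> diffusion_poly (2 ^+ j) Q ->
    diffusion_poly (C * 2 ^+ j) (fun x => P x * (Q x)^*).

Definition product_bandwidth_constant (C : R) : Prop :=
  2 <= C /\ forall j, product_condition C j.

End polynomials.

Definition exact_rule {R : realType} {M : ptopologicalType}
    (mu : {measure set (borel M) -> \bar R}) (u : nat -> M -> R[i])
    (lam : nat -> R) (X : {fset M}) (w : M -> R) (n : R) : Prop :=
  forall P : M -> R[i], diffusion_poly u lam n P ->
    Cintegral mu (P : borel M -> R[i]) = \sum_(x <- X) ((w x)%:C)%C * P x.

(* The index set is finite under the standing assumptions (band-limited
   generator and lam -> oo). *)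
Definition Lambda {R : realType} (lam : nat -> R) (alpha : R -> R[i])
    (j : nat) : {fset nat} :=
  fset_set [set l | fourier alpha (lam l / 2 ^+ j) != 0].

Definition cdot {R : realType} (I : finType) (v z : {ffun I -> R[i]}) : R[i] :=
  \sum_i v i * (z i)^*.

Section framelets.
Context {R : realType} {M : ptopologicalType} {r : nat}.
Variables (u : nat -> M -> R[i]) (lam : nat -> R) (alpha : R -> R[i]).
Variables (a : int -> R[i]) (b : 'I_r -> int -> R[i]).
Variables (X : nat -> {fset M}) (w : nat -> M -> R).

Local Notation C := R[i].
Local Notation L := (Lambda lam alpha).

(* extension by zero; in particular C^(Lambda_(j-1)) -> C^(Lambda_j) *)
Definition zext (A : {fset nat}) (v : {ffun A -> C}) : nat -> C :=
  fun l => if insub l is Some i then v i else 0.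

Definition sampling (j : nat) (z : {ffun L j -> C}) : {ffun X j -> C} :=
  [ffun x => \sum_(l : L j)
     z l * ((Num.sqrt (w j (val x)))%:C)%C * u (val l) (val x)].

Definition sampling_adj (j : nat) (v : {ffun X j -> C}) : {ffun L j -> C} :=
  [ffun l => \sum_(x : X j)
     v x * ((Num.sqrt (w j (val x)))%:C)%C * (u (val l) (val x))^*].

Variables (J K : nat).

(* C^(X_J) x \prod_(J < j <= K) (C^(X_j))^r: the index [i : 'I_(K - J)]
   stands for the level j = (J + i).+1, so that [c.2 i k] is c^k_(j-1). *)
Definition coeffs : Type :=
  ({ffun X J -> C} *
   (forall i : 'I_(K - J), 'I_r -> {ffun X (J + i).+1 -> C}))%type.

Definition coeffs_dot (c c' : coeffs) : C :=
  cdot c.1 c'.1 + \sum_(i < K - J) \sum_(k < r) cdot (c.2 i k) (c'.2 i k).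

(* [vhat v n] is the vector \hat v_(K-n), extended by zero *)
Fixpoint vhat (v : {ffun L K -> C}) (n : nat) : nat -> C :=
  if n is m.+1 then
    zext [ffun l : L (K - m.+1) =>
      vhat v m (val l) * (symbol a (lam (val l) / 2 ^+ (K - m)))^*]
  else zext v.

Definition analysis (v : {ffun L K -> C}) : coeffs :=
  (sampling [ffun l : L J => vhat v (K - J) (val l)],
   fun (i : 'I_(K - J)) k => let j := (J + i).+1 in
     sampling [ffun l : L j =>
       vhat v (K - j) (val l) * (symbol (b k) (lam (val l) / 2 ^+ j))^*]).

(* one pass of the loop, at level j = (J + i).+1; the state is \hat z_(j-1)
   extended by zero *)
Definition synthesis_step (c : coeffs) (z : nat -> C) (i : 'I_(K - J)) :
    nat -> C :=
  let j := (J + i).+1 in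
  zext [ffun l : L j =>
    z (val l) * symbol a (lam (val l) / 2 ^+ j) +
    \sum_(k < r) sampling_adj (c.2 i k) l *
                 symbol (b k) (lam (val l) / 2 ^+ j)].

Definition synthesis (c : coeffs) : {ffun L K -> C} :=
  [ffun l => foldl (synthesis_step c) (zext (sampling_adj c.1))
               (enum 'I_(K - J)) (val l)].

Definition is_adjoint (A : {ffun L K -> C} -> coeffs)
    (B : coeffs -> {ffun L K -> C}) : Prop :=
  forall v c, coeffs_dot (A v) c = cdot v (B c).

Lemma adjoint_unique A B B' : is_adjoint A B -> is_adjoint A B' -> B =1 B'.
Proof.
move=> AB AB' c; apply/ffunP => l.
have pick (z : {ffun L K -> C}) : cdot [ffun i => (i == l)%:R] z = (z l)^*.
  rewrite /cdot (bigD1 l)//= ffunE eqxx mul1r big1 ?addr0// => i /negbTE il.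
  by rewrite ffunE il mul0r.
by apply: (can_inj conjCK); rewrite -!pick -AB AB'.
Qed.

End framelets.
Arguments analysis {R M r} u lam alpha a b X w J K v.
Arguments synthesis {R M r} u lam alpha a b X w J K c.
Arguments is_adjoint {R M r lam alpha X J K} A B.
Arguments coeffs R {M} r X J K.

(* Main.v *)
Require Import Defs.

From mathcomp Require Import ring.

Local Open Scope classical_set_scope.
Local Open Scope ring_scope.

(** By exactness and the product condition, the sampled eigenfunctions
    [w^(1/2) u_l] with [l] in [Lambda_j] are orthonormal, so [F_j^* F_j = I].
    The synthesis algorithm is the adjoint of the analysis operator. Applied to
    analysis coefficients it reproduces, level by level, the intermediate vector
    of the analysis recursion: for [l] in [Lambda_(j-1)] this is the
    filter-bank partition, and for [l] in [Lambda_j] but not in [Lambda_(j-1)]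
    the refinement relation forces [\hat a(lam_l / 2^j) = 0], so that the
    truncation to [Lambda_(j-1)] loses nothing. *)

(** Loop-invariant rule for the synthesis pass, where [P i] will describe the state after [i] levels
    above [J]. The induction runs over the prefixes [take i] of the enumeration. *)
Lemma foldl_enum_ord_ind (T : Type) (n : nat) (f : T -> 'I_n -> T)
    (P : nat -> T -> Prop) (z : T) :
  P 0%N z -> (forall (i : 'I_n) t, P i t -> P i.+1 (f t i)) ->
  P n (foldl f z (enum 'I_n)).
Proof.
move=> P0 PS.
suff H i : (i <= n)%N -> P i (foldl f z (take i (enum 'I_n))).
  by have := H n (leqnn n); rewrite take_oversize// size_enum_ord.
elim: i => [|i IH] lt_in; first by rewrite take0.
have i_lt : (i < size (enum 'I_n))%N by rewrite size_enum_ord.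
rewrite (take_nth (Ordinal lt_in))// -cats1 foldl_cat /=.
by rewrite (nth_ord_enum (Ordinal lt_in) (Ordinal lt_in));
  apply: (PS (Ordinal lt_in)) (IH (ltnW lt_in)).
Qed.

(** * Sampling and its adjoint at a single level *)

Section framelet_lemmas.
Context {R : realType} {M : ptopologicalType}.
Variables (u : nat -> M -> R[i]) (lam : nat -> R) (alpha : R -> R[i]).
Variables (X : nat -> {fset M}) (w : nat -> M -> R).

Local Notation C := R[i].
Local Notation L := (Lambda lam alpha).

Lemma zextE (A : {fset nat}) (F : nat -> C) (l : nat) :
  zext [ffun i : A => F (val i)] l = if l \in A then F l else 0.
Proof.
rewrite /zext; case: insubP => [i iA <-|/negbTE ->//].
by rewrite ffunE (valP i).
Qed.

Lemma zext_val (A : {fset nat}) (v : {ffun A -> C}) (i : A) : zext v (val i) = v i.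
Proof. by rewrite /zext valK. Qed.

Lemma zext_out (A : {fset nat}) (v : {ffun A -> C}) (l : nat) :
  l \notin A -> zext v l = 0.
Proof. by move=> lA; rewrite /zext insubN. Qed.

(** The formula of [F_j^*] is kept for every natural [l], not only for [l] in [Lambda_j], so that
    vectors of different levels can be compared as functions on [nat]. *)
Definition sampling_coef {j : nat} (v : {ffun X j -> C}) (l : nat) : C :=
  \sum_(x : X j) v x * ((Num.sqrt (w j (val x)))%:C)%C * (u l (val x))^*.

Lemma sampling_adjE j (v : {ffun X j -> C}) :
  sampling_adj u lam alpha w v = [ffun l : L j => sampling_coef v (val l)].
Proof. by apply/ffunP => l; rewrite !ffunE. Qed.

(** Adjointness of [F_j] and [F_j^*]: the two finite sums are exchanged, and the square roots of the
    weights are real, hence fixed by conjugation. *)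
Lemma cdot_sampling j (F : nat -> C) (v : {ffun X j -> C}) :
  cdot (sampling u X w [ffun l : L j => F (val l)]) v =
  \sum_(l <- L j) F l * (sampling_coef v l)^*.
Proof.
rewrite big_seq_fsetE /cdot /=.
under eq_bigr do rewrite ffunE mulr_suml.
rewrite exchange_big; apply: eq_bigr => l _ /=.
rewrite rmorph_sum mulr_sumr; apply: eq_bigr => x _.
rewrite ffunE !rmorphM /= conjCK.
have -> : (((Num.sqrt (w j (val x)))%:C)%C : C)^* = ((Num.sqrt (w j (val x)))%:C)%C.
  by apply/conj_Creal; rewrite complex_real.
by ring.
Qed.

(* Exactness turns the Gram matrix of the sampled [u_l] into that of the
   [u_l] in L^2, i.e. the identity. *)
Lemma sampling_coefK (mu : probability (borel M) R) (n : R) j (F : nat -> C) (m : nat) :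
  orthonormal_basis mu (u : nat -> borel M -> R[i]) ->
  (forall x, x \in X j -> 0 < w j x) ->
  (forall l, l \in L j -> lam l <= 2 ^+ j) ->
  exact_rule mu u lam (X j) (w j) (n * 2 ^+ j) ->
  product_condition u lam n j ->
  m \in L j ->
  sampling_coef (sampling u X w [ffun l : L j => F (val l)]) m = F m.
Proof.
move=> [_ orth _] w_pos lam_le exact prod mL.
have basis_poly l : l \in L j -> diffusion_poly u lam (2 ^+ j) (u l).
  move=> lL; exists [:: l], (fun=> 1); split.
    by move=> k; rewrite inE => /eqP ->; apply: lam_le.
  by apply/funext => x; rewrite big_seq1 mul1r.
have gram l : l \in L j ->
    \sum_(x : X j) ((w j (val x))%:C)%C * (u l (val x) * (u m (val x))^*) = (l == m)%:R.
  move=> lL; rewrite -orth /L2dot.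
  rewrite (exact _ (prod _ _ (basis_poly l lL) (basis_poly m mL))).
  by rewrite big_seq_fsetE.
rewrite /sampling_coef.
under eq_bigr => x _.
  rewrite ffunE.
  under eq_bigr do rewrite ffunE.
  rewrite -mulrA mulr_suml.
  over.
rewrite exchange_big /=.
transitivity (\sum_(l : L j) F (val l) * (val l == m)%:R).
  apply: eq_bigr => l _; rewrite -gram ?(valP l)// mulr_sumr.
  apply: eq_bigr => x _.
  (* One square root comes from [sampling] and one from its adjoint; positivity of the weight lets
     them merge into the weight of the quadrature rule. *)
  have <- : ((Num.sqrt (w j (val x)))%:C)%C * ((Num.sqrt (w j (val x)))%:C)%C
            = ((w j (val x))%:C)%C.
    by rewrite -rmorphM /= -expr2 sqr_sqrtr// ltW// w_pos// (valP x).
  by ring.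
rewrite (bigD1 [` mL]%fset)//= eqxx mulr1 big1 ?addr0// => l lm.
have -> : (val l == m) = false by apply/negbTE.
by rewrite mulr0.
Qed.

(** * Index sets cut out by the band-limited generator *)

Lemma mem_Lambda_le j l :
  (support (fourier alpha) `&` `[0, +oo[ `<=` `[0, 1]) ->
  0 <= lam l -> fourier alpha (lam l / 2 ^+ j) != 0 -> lam l <= 2 ^+ j.
Proof.
move=> supp lam_ge0 neq0.
have : `[0, 1]%classic (lam l / 2 ^+ j).
  apply: supp; split; first exact: subset_closure.
  by rewrite /= in_itv /= andbT divr_ge0// exprn_ge0.
by rewrite /= in_itv /= => /andP[_]; rewrite ler_pdivrMr ?exprn_gt0// mul1r.
Qed.

(** [fset_set] is empty by default on an infinite set, so finiteness has to come first: since [lam]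
    tends to infinity, only indices below some [N] satisfy [lam l <= 2 ^+ j]. *)
Lemma in_Lambda j l :
  (support (fourier alpha) `&` `[0, +oo[ `<=` `[0, 1]) ->
  (forall l, 0 <= lam l) -> lam l @[l --> \oo] --> +oo ->
  (l \in L j) = (fourier alpha (lam l / 2 ^+ j) != 0).
Proof.
move=> supp lam_ge0 lam_oo; rewrite /Lambda in_fset_set ?mem_setE//; last first.
  have /cvgryPgt/(_ (2 ^+ j)) [N _ lam_gt] := lam_oo.
  apply: (sub_finite_set _ (finite_II N)) => k /= neq0.
  rewrite ltnNge; apply/negP => Nk.
  by have := lam_gt k Nk; rewrite /= ltNge (mem_Lambda_le _ _ supp).
Qed.


(** * The downward analysis recursion and the upward synthesis pass *)

Section one_pass.
Context {r : nat}.
Variables (a : int -> R[i]) (b : 'I_r -> int -> R[i]) (J K : nat).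
Variable v : {ffun L K -> C}.

(** [vhat] counts depth below [K]; here its recursion is read by level. The bound [j < K] makes
    [K - j] a successor, so that one step unfolds and the truncated subtractions are exact. *)
Lemma vhat_step j l : (j < K)%N ->
  vhat a v (K - j) l =
  if l \in L j then vhat a v (K - j.+1) l * (symbol a (lam l / 2 ^+ j.+1))^* else 0.
Proof.
move=> jK; rewrite -(subnSK jK); set m := (K - j.+1)%N.
have <- : (K - m = j.+1)%N by rewrite subKn.
have <- : (K - m.+1 = j)%N by rewrite subnSK// subKn// ltnW.
exact: (zextE _ (fun l => vhat a v m l * (symbol a (lam l / _))^*)).
Qed.

Lemma vhat_out j l : (j <= K)%N -> l \notin L j -> vhat a v (K - j) l = 0.
Proof.
rewrite leq_eqVlt => /predU1P[->|jK] lL; last by rewrite vhat_step// (negbTE lL).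
by rewrite subnn /= zext_out.
Qed.

Lemma synthesis_stepE (c : coeffs R r X J K) (z : nat -> C) (i : 'I_(K - J)) l :
  synthesis_step u lam alpha a b w c z i l =
  if l \in L (J + i).+1 then
    z l * symbol a (lam l / 2 ^+ (J + i).+1) +
    \sum_(k < r) sampling_coef (c.2 i k) l * symbol (b k) (lam l / 2 ^+ (J + i).+1)
  else 0.
Proof.
rewrite -(zextE _ (fun l => z l * symbol a (lam l / 2 ^+ (J + i).+1) +
  \sum_(k < r) sampling_coef (c.2 i k) l * symbol (b k) (lam l / 2 ^+ (J + i).+1))).
congr (zext _ l); apply/ffunP => m; rewrite !ffunE; congr (_ + _).
by apply: eq_bigr => k _; rewrite ffunE.
Qed.

(** The pairing of [vhat] with the synthesis state at level [J + i] accumulates the coarse inner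
    product and the first [i] detail terms. At level [K], [vhat] is [v] itself and all the terms
    have been collected. *)
Lemma cdot_analysis (c : coeffs R r X J K) :
  (J <= K)%N ->
  (forall j, (J <= j)%N -> (L j `<=` L j.+1)%fset) ->
  coeffs_dot (analysis u lam alpha a b X w J K v) c =
  cdot v (synthesis u lam alpha a b X w J K c).
Proof.
move=> JK nested.
pose details (i : 'I_(K - J)) : C :=
  \sum_(k < r) cdot ((analysis u lam alpha a b X w J K v).2 i k) (c.2 i k).
(* The vanishing of the state outside [L (J + i)] is carried along because each step enlarges the
   sum to the next index set. *)
pose inv (i : nat) (z : nat -> C) :=
  (forall l, l \notin L (J + i) -> z l = 0) /\
  \sum_(l <- L (J + i)) vhat a v (K - (J + i)) l * (z l)^* =
  cdot (analysis u lam alpha a b X w J K v).1 c.1 + \sum_(n < K - J | (n < i)%N) details n.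
set z := foldl (synthesis_step u lam alpha a b w c)
  (zext (sampling_adj u lam alpha w c.1)) (enum 'I_(K - J)).
have [_] : inv (K - J)%N z.
  apply: foldl_enum_ord_ind => [|i t [t_out IH]]; split.
  - by move=> l; rewrite addn0 => lL; apply: zext_out.
  - rewrite addn0 [X in _ + X]big_pred0// addr0 cdot_sampling.
    apply: eq_big_seq => l lL.
    by rewrite sampling_adjE zextE lL.
  - by move=> l; rewrite addnS synthesis_stepE => /negbTE ->.
  rewrite addnS [X in _ + X](bigD1 i)//= addrCA.
  have -> : \sum_(n < K - J | (n < i.+1)%N && (n != i)) details n =
            \sum_(n < K - J | (n < i)%N) details n.
    by apply: eq_bigl => n; rewrite ltnS ltn_neqAle andbC.
  rewrite -IH.
  have lt_iK : (J + i < K)%N by rewrite -ltn_subRL.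
  rewrite [X in _ + X](big_fset_incl _ (nested _ (leq_addr i J))); last first.
    by move=> l _ /t_out ->; rewrite conjC0 mulr0.
  rewrite /details.
  under [X in X + _]eq_bigr => k _.
    rewrite (cdot_sampling _ (fun l => vhat a v (K - (J + i).+1) l *
      (symbol (b k) (lam l / 2 ^+ (J + i).+1))^*)).
    over.
  rewrite exchange_big -big_split; apply: eq_big_seq => l lL /=.
  rewrite synthesis_stepE lL rmorphD rmorph_sum mulrDr mulr_sumr addrC rmorphM /=.
  congr (_ + _); last by apply: eq_bigr => k _; rewrite rmorphM /=; ring.
  (* The low-pass factor passes from the state to [vhat] with a conjugation. Outside [L (J + i)]
     both sides vanish because the old state does. *)
  rewrite [in RHS](vhat_step _ l lt_iK); case: ifPn => [_|/t_out ->]; first by ring.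
  by rewrite conjC0 mul0r !mulr0.
rewrite subnKC// subnn /= big_seq_fsetE /= => zE.
rewrite /coeffs_dot.
transitivity (cdot (analysis u lam alpha a b X w J K v).1 c.1 +
  \sum_(n < K - J | (n < K - J)%N) details n).
  by congr (_ + _); apply: eq_bigl => n; rewrite ltn_ord.
by rewrite -zE; apply: eq_bigr => l _; rewrite ffunE zext_val.
Qed.

Lemma synthesis_analysis :
  (J <= K)%N ->
  (forall j (F : nat -> C) l, (J <= j <= K)%N -> l \in L j ->
     sampling_coef (sampling u X w [ffun m : L j => F (val m)]) l = F l) ->
  (forall j l, (J <= j)%N -> l \in L j.+1 -> l \notin L j ->
     symbol a (lam l / 2 ^+ j.+1) = 0) ->
  (forall j l, (J < j)%N -> l \in L j ->
     `|symbol a (lam l / 2 ^+ j)| ^+ 2 +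
     \sum_(k < r) `|symbol (b k) (lam l / 2 ^+ j)| ^+ 2 = 1) ->
  synthesis u lam alpha a b X w J K (analysis u lam alpha a b X w J K v) = v.
Proof.
move=> JK isometry kill partition.
set c := analysis _ _ _ _ _ _ _ _ _ _.
set z := foldl (synthesis_step u lam alpha a b w c)
  (zext (sampling_adj u lam alpha w c.1)) (enum 'I_(K - J)).
have zE : forall l, z l = vhat a v (K - (J + (K - J))) l.
  (* The invariant holds at every natural [l], both sides being zero outside [L (J + i)]. *)
  pose inv (i : nat) (t : nat -> C) := forall l, t l = vhat a v (K - (J + i)) l.
  apply: (@foldl_enum_ord_ind _ _ _ inv) => [l|i t IH l].
    rewrite addn0 sampling_adjE zextE; case: ifPn => lL; last by rewrite vhat_out.
    by rewrite isometry// leqnn.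
  have lt_iK : (J + i < K)%N by rewrite -ltn_subRL.
  rewrite addnS synthesis_stepE; case: ifPn => lL; last by rewrite vhat_out.
  rewrite IH [in LHS](vhat_step _ l lt_iK).
  have -> : \sum_(k < r) sampling_coef (c.2 i k) l *
      symbol (b k) (lam l / 2 ^+ (J + i).+1) =
      vhat a v (K - (J + i).+1) l *
      \sum_(k < r) `|symbol (b k) (lam l / 2 ^+ (J + i).+1)| ^+ 2.
    rewrite mulr_sumr; apply: eq_bigr => k _.
    pose F m := vhat a v (K - (J + i).+1) m *
      (symbol (b k) (lam m / 2 ^+ (J + i).+1))^*.
    rewrite (isometry _ F)//; first by rewrite normCK /F; ring.
    by rewrite lt_iK ltnW// ltnS leq_addr.
  (* On indices new at this level the left side is zero by truncation, and the right side is zero by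
     [kill]. *)
  have -> : (if l \in L (J + i) then
      vhat a v (K - (J + i).+1) l * (symbol a (lam l / 2 ^+ (J + i).+1))^* else 0) *
      symbol a (lam l / 2 ^+ (J + i).+1) =
      vhat a v (K - (J + i).+1) l * `|symbol a (lam l / 2 ^+ (J + i).+1)| ^+ 2.
    case: ifPn => [_|lL']; first by rewrite normCK; ring.
    by rewrite kill ?leq_addr// normr0 expr0n /= !mulr0.
  by rewrite -mulrDr partition ?mulr1// ltnS leq_addr.
apply/ffunP => l; rewrite ffunE -/z zE.
by rewrite subnKC// subnn /= zext_val.
Qed.

End one_pass.

End framelet_lemmas.

Theorem proposition5p3 (R : realType)
  (d : nat) (M : ptopologicalType) (g : riemannian R d M)
  (M_hausdorff : hausdorff_space M)
  (M_compact : compact [set: M]) (M_connected : connected [set: M])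
  (mu : probability (borel M) R) (mu_volume : normalized_volume g mu)
  (u : nat -> M -> R[i]) (lam : nat -> R)
  (u_basis : orthonormal_basis mu (u : nat -> borel M -> R[i]))
  (u_eigen : forall l, laplace_eigenfun g (lam l ^+ 2) (fun x => complex.Re (u l x)) /\
                       laplace_eigenfun g (lam l ^+ 2) (fun x => complex.Im (u l x)))
  (lam_0 : lam 0%N = 0) (lam_mono : forall l, lam l <= lam l.+1)
  (lam_infty : lam l @[l --> \oo] --> +oo)
  (r : nat) (alpha : R -> R[i]) (beta : 'I_r -> R -> R[i])
  (a : int -> R[i]) (b : 'I_r -> int -> R[i])
  (alpha_L1 : Cintegrable (@lebesgue_measure R) alpha)
  (beta_L1 : forall k, Cintegrable (@lebesgue_measure R) (beta k))
  (supp_gen :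
     (support (fourier alpha) `&` `[0, +oo[) `|`
     \bigcup_(k in [set: 'I_r]) (support (fourier (beta k)) `&` `[0, +oo[)
     `<=` `[0, 1])
  (a_l1 : in_l1 a) (b_l1 : forall k, in_l1 (b k))
  (J K : nat) (JK : (J < K)%N)
  (Lambda_nested : forall j, (J <= j)%N ->
     (Lambda lam alpha j `<=` Lambda lam alpha j.+1)%fset)
  (X : nat -> {fset M}) (w : nat -> M -> R)
  (X_nested : forall j, (J <= j)%N -> (X j `<=` X j.+1)%fset)
  (w_pos : forall j x, (J <= j)%N -> x \in X j -> 0 < w j x)
  (refine_alpha : forall xi : R,
     fourier alpha (2 * xi) = symbol a xi * fourier alpha xi)
  (refine_beta : forall (k : 'I_r) (xi : R),
     fourier (beta k) (2 * xi) = symbol (b k) xi * fourier alpha xi)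
  (partition_unity : forall j l, (J < j)%N -> l \in Lambda lam alpha j ->
     `|symbol a (lam l / 2 ^+ j)| ^+ 2 +
     \sum_(k < r) `|symbol (b k) (lam l / 2 ^+ j)| ^+ 2 = 1)
  (Cprod : R) (Cprod_const : product_bandwidth_constant u lam Cprod)
  (exactness : forall j, (J <= j <= K)%N ->
     exact_rule mu u lam (X j) (w j) (Cprod * 2 ^+ j))
  (product : forall j, (J <= j <= K)%N -> product_condition u lam Cprod j) :
  (exists Astar : coeffs R r X J K -> {ffun Lambda lam alpha K -> R[i]},
     is_adjoint (analysis u lam alpha a b X w J K) Astar /\
     forall v, Astar (analysis u lam alpha a b X w J K v) = v) /\
  (forall (v : {ffun Lambda lam alpha K -> R[i]}) (c : coeffs R r X J K),
     c = analysis u lam alpha a b X w J K v ->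
     synthesis u lam alpha a b X w J K c = v).
Proof.
(* Needed because the support assumption constrains frequencies in the half-line from 0 only. *)
have lam_ge0 l : 0 <= lam l by elim: l => [|l /le_trans]; [rewrite lam_0|apply].
have supp_alpha : support (fourier alpha) `&` `[0, +oo[ `<=` `[0, 1].
  by move=> x ax; apply: supp_gen; left.
have LE j l : (l \in Lambda lam alpha j) = (fourier alpha (lam l / 2 ^+ j) != 0).
  exact: in_Lambda.
have synthesisK v : synthesis u lam alpha a b X w J K
    (analysis u lam alpha a b X w J K v) = v.
  apply: synthesis_analysis => //; first exact: ltnW.
  - move=> j F l /[dup] jJK /andP[Jj _] lL.
    apply: (sampling_coefK u lam alpha X w mu Cprod j F l u_basis _ _
              (exactness _ jJK) (product _ jJK) lL).
      by move=> x; apply: w_pos.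
    by move=> m; rewrite LE; apply: mem_Lambda_le.
  - move=> j l _ lS lL; apply/eqP.
    have neq0 : fourier alpha (lam l / 2 ^+ j.+1) != 0 by rewrite -LE.
    have /eqP eq0 : fourier alpha (lam l / 2 ^+ j) == 0 by rewrite -[_ == _]negbK -LE.
    (* The refinement relation is taken at the level [j.+1] frequency, whose double is the level [j]
       frequency. *)
    have := refine_alpha (lam l / 2 ^+ j.+1).
    have -> : 2 * (lam l / 2 ^+ j.+1) = lam l / 2 ^+ j.
      by rewrite exprS invfM mulrCA mulVKf// pnatr_eq0.
    by move=> /esym/eqP; rewrite eq0 mulf_eq0 (negbTE neq0) orbF.
split; last by move=> v c ->; apply: synthesisK.
(* The synthesis map is the adjoint, the only one by [adjoint_unique], so both conclusions reduce to
   [synthesisK]. *)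
exists (synthesis u lam alpha a b X w J K); split=> // v c.
by apply: cdot_analysis => //; apply: ltnW.
Qed.
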